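(* For any $\Delta>0$, let $L_\Delta,r_\Delta,\ell_\Delta$ be the constants of the context. For any $0<\alpha\le r_\Delta$ and integer $h\ge1$, define $$\varepsilon_h=\frac{d f_{2\Delta}D_X^2}{2\alpha}\Big(1-\frac{\lambda_{\min}(Q)}{f_{2\Delta}}\Big)^h .$$ Then the estimator $G_t=G_h^\alpha(K_t)$ satisfies, for any $0<\delta<1$ and any $K_t$ with $\Delta(K_t)\le\Delta$, $$\|\mathbb{E}[G_t|\mathcal{F}_t]-\nabla f(K_t)\|\le b,\quad \mathbb{E}[\|G_t\|^2|\mathcal{F}_t]\le V_\Delta,\quad \mathbb{P}(\|G_t\|\le M_{\Delta,\delta}|\mathcal{F}_t)\ge1-\delta,$$ with $b=L_\Delta\alpha+\varepsilon_h$, $V_\Delta=(d\ell_\Delta+\varepsilon_h)^2$, $M_{\Delta,\delta}=d\ell_\Delta+\varepsilon_h$.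
   Context: LQR problem. Let $A\in\mathbb{R}^{n\times n}$, $B\in\mathbb{R}^{n\times m}$, let $Q\in\mathbb{R}^{n\times n}$, $R\in\mathbb{R}^{m\times m}$ be positive definite matrices, and let $\mathcal{D}$ be a distribution on $\mathbb{R}^n$ with $\mathbb{E}_{x_0\sim\mathcal{D}}[x_0x_0^\top]=I_n$ and $\|x_0\|\le D_X$ for some $D_X>0$. For a policy $K\in\mathbb{R}^{m\times n}$ let $f(K)=\mathbb{E}_{x_0\sim\mathcal{D}}\big[\sum_{i\ge0}(x_i^\top Qx_i+a_i^\top Ra_i)\big]$, where $x_{i+1}=Ax_i+Ba_i$, $a_i=-Kx_i$. Let $f^*=\min_K f(K)$, assumed finite, $\Delta(K)=f(K)-f^*$, and $f_{\Delta}=f^*+\Delta$ for $\Delta>0$ (so $f_{2\Delta}=f^*+2\Delta$). A policy $K$ is stable if $\rho(A-BK)<1$, where $\rho$ is the spectral radius; this is equivalent to $\Delta(K)<\infty$. $\|\cdot\|$ is the Euclidean norm of vectors and the Frobenius norm of matrices, $\langle\cdot,\cdot\rangle$ the associated inner product, and $\lambda_{\min}$ the smallest eigenvalue. Estimators. Let $d=mn$. For $x\in\mathbb{R}^n$ and integer $h\ge1$ let $x_i=(A-BK)^ix$, $F(K;x)=\sum_{i\ge0}x_i^\top(Q+K^\top RK)x_i$, $F_h(K;x)=\sum_{0\le i<h}x_i^\top(Q+K^\top RK)x_i$. For $\alpha>0$, sample $x_0\sim\mathcal{D}$ and, independently, $U$ uniform on the unit sphere of $\mathbb{R}^{m\times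 n}$, and set $G^\alpha(K)=\frac{d}{2\alpha}\big(F(K+\alpha U;x_0)-F(K-\alpha U;x_0)\big)U$ and $G_h^\alpha(K)=\frac{d}{2\alpha}\big(F_h(K+\alpha U;x_0)-F_h(K-\alpha U;x_0)\big)U$. Here $K_t$ is the policy at iteration $t$ of an iterative method, $\mathcal{F}_t$ is the filtration of the method up to, excluding, iteration $t$ (so $K_t$ is $\mathcal{F}_t$-measurable), and the samples $(x_0,U)$ used at iteration $t$ are independent of $\mathcal{F}_t$. Constants. There is $\mu>0$ such that for each $\Delta>0$ one can choose $L_\Delta,r_\Delta>0$ so that for every policy $K$ with $\Delta(K)<\Delta$: every $K'$ with $\|K'-K\|\le r_\Delta$ is stable and satisfies $f(K')\le f(K)+\langle\nabla f(K),K'-K\rangle+\frac{L_\Delta}{2}\|K-K'\|^2$; and $\mu\Delta(K)\le\|\nabla f(K)\|^2\le2L_\Delta\Delta(K)$. These are the constants $L_\Delta,r_\Delta$. Moreover $\ell_\Delta\ge0$ is a constant (known to exist) such that for every $0<\alpha\le r_\Delta$ the infinite-horizon estimator satisfies, for any $0<\delta<1$ and any $K_t$ with $\Delta(K_t)\le\Delta$, $\|\mathbb{E}[G^\alpha(K_t)|\mathcal{F}_t]-\nabla f(K_t)\|\le L_\Delta\alpha$, $\mathbb{E}[\|G^\alpha(K_t)\|^2|\mathcal{F}_t]\le d^2\ell_\Delta^2$, and $\mathbb{P}(\|G^\alpha(K_t)\|\le d\ell_\Delta|\mathcal{F}_t)\ge1-\delta$.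
   Formalization: The radius r_Δ is additionally required to satisfy f(K') ≤ f_{2Δ} whenever Δ(K)<Δ and ‖K'−K‖ ≤ r_Δ; the listed properties of r_Δ do not imply this, the claim fails without it, and it holds once r_Δ is chosen small enough. *)

(* Defs.v *)
From HB Require Import structures.
From mathcomp Require Import all_boot all_order all_algebra.
From mathcomp Require Import all_classical all_reals all_analysis.
From mathcomp Require Import complex.

Set Implicit Arguments.
Unset Strict Implicit.
Unset Printing Implicit Defensive.

Import Order.TTheory GRing.Theory Num.Theory.
Import numFieldNormedType.Exports.

Local Open Scope classical_set_scope.
Local Open Scope ring_scope.

(* The library norm on 'M[R]_(m, n) is the max norm: it only supplies the
   topology here. On column vectors, fnorm is the Euclidean norm. *)
Definition fnorm (R : realType) (m n : nat) (M : 'M[R]_(m, n)) : R :=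
  Num.sqrt (\sum_i \sum_j M i j ^+ 2).

Definition fdot (R : realType) (m n : nat) (M N : 'M[R]_(m, n)) : R :=
  \sum_i \sum_j M i j * N i j.

Definition qform (R : realType) (n : nat) (Q : 'M[R]_n) (x : 'cV[R]_n) : R :=
  (x^T *m Q *m x) 0 0.

Definition posdef (R : realType) (n : nat) (Q : 'M[R]_n) : Prop :=
  Q^T = Q /\ forall x : 'cV[R]_n, x != 0 -> 0 < qform Q x.

(* Meant for symmetric Q, whose eigenvalues are all real. *)
Definition lambda_min (R : realType) (n : nat) (Q : 'M[R]_n) : R :=
  inf [set a | eigenvalue Q a].

Definition spectral_radius (R : realType) (n : nat) (M : 'M[R]_n) : R :=
  sup [set Normc.normc z | z in
         [set z : R[i] | eigenvalue (map_mx (real_complex R) M) z]].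

Definition borel (R : realType) (m n : nat) :
    measurableType (@open 'M[R]_(m, n)).-sigma :=
  g_sigma_algebraType (@open 'M[R]_(m, n)).

Record lqr (R : realType) (m n : nat) := LQR {
  sysA : 'M[R]_n;
  sysB : 'M[R]_(n, m);
  costQ : 'M[R]_n;
  costR : 'M[R]_m }.

Definition action (R : realType) (m n : nat)
    (K : 'M[R]_(m, n)) (x : 'cV[R]_n) : 'cV[R]_m := - K *m x.

Definition state (R : realType) (m n : nat) (S : lqr R m n)
    (K : 'M[R]_(m, n)) (x0 : 'cV[R]_n) (i : nat) : 'cV[R]_n :=
  iter i (fun x => sysA S *m x + sysB S *m action K x) x0.

Definition cost (R : realType) (m n : nat) (S : lqr R m n)
    (D : probability (borel R n 1) R) (K : 'M[R]_(m, n)) : \bar R :=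
  (\int[D]_x0 \sum_(0 <= i <oo)
     (qform (costQ S) (state S K x0 i) +
      qform (costR S) (action K (state S K x0 i)))%:E)%E.

Definition is_min_cost (R : realType) (m n : nat) (S : lqr R m n)
    (D : probability (borel R n 1) R) (fstar : R) : Prop :=
  (exists K, cost S D K = fstar%:E) /\ forall K, (fstar%:E <= cost S D K)%E.

Definition gap (R : realType) (m n : nat) (S : lqr R m n)
    (D : probability (borel R n 1) R) (fstar : R) (K : 'M[R]_(m, n)) : \bar R :=
  (cost S D K - fstar%:E)%E.

Definition stable (R : realType) (m n : nat) (S : lqr R m n)
    (K : 'M[R]_(m, n)) : Prop :=
  spectral_radius (sysA S - sysB S *m K) < 1.

(* Meaningful at stable K: the cost is finite in a neighbourhood of such K,
   so that fine does not interfere. *)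
Definition grad_cost (R : realType) (m n : nat) (S : lqr R m n)
    (D : probability (borel R n 1) R) (K : 'M[R]_(m, n)) : 'M[R]_(m, n) :=
  \matrix_(i, j) 'D_(delta_mx i j) (fun K' => fine (cost S D K')) K.

Definition state_law (R : realType) (n : nat)
    (D : probability (borel R n 1) R) (DX : R) : Prop :=
  (forall i j : 'I_n, (\int[D]_x ((x : 'cV[R]_n) i 0 * (x : 'cV[R]_n) j 0)%:E
     = ((1%:M : 'M[R]_n) i j)%:E)%E) /\
  {ae D, forall x, fnorm (x : 'cV[R]_n) <= DX}.

Definition smoothness_constants (R : realType) (m n : nat) (S : lqr R m n)
    (D : probability (borel R n 1) R) (fstar mu Delta L r : R) : Prop :=
  [/\ 0 < L, 0 < r &
    forall K : 'M[R]_(m, n), (gap S D fstar K < Delta%:E)%E ->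
      (forall K' : 'M[R]_(m, n), fnorm (K' - K) <= r ->
         stable S K' /\
         (cost S D K' <= (fine (cost S D K) + fdot (grad_cost S D K) (K' - K)
                          + L / 2 * fnorm (K - K') ^+ 2)%:E)%E) /\
      mu * fine (gap S D fstar K) <= fnorm (grad_cost S D K) ^+ 2
        <= 2 * L * fine (gap S D fstar K)].

(* The r-neighbourhood of the Delta-sublevel set lies in the 2 Delta-sublevel
   set. This does not follow from smoothness_constants (the quadratic upper
   bound may exceed f_{2 Delta} when r is large), but it holds as soon as r is
   small enough, and smoothness_constants is preserved when r decreases. *)
Definition radius_in_double_sublevel (R : realType) (m n : nat)
    (S : lqr R m n) (D : probability (borel R n 1) R)
    (fstar Delta r : R) : Prop :=
  forall K K' : 'M[R]_(m, n), (gap S D fstar K < Delta%:E)%E ->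
    fnorm (K' - K) <= r -> (cost S D K' <= (fstar + 2 * Delta)%:E)%E.

Definition closed_loop_cost (R : realType) (m n : nat) (S : lqr R m n)
    (K : 'M[R]_(m, n)) (x : 'cV[R]_n) (i : nat) : R :=
  qform (costQ S + K^T *m costR S *m K) ((sysA S - sysB S *m K) ^+ i *m x).

(* If the series diverges, which happens only for unstable K, the value is the
   junk value 0. *)
Definition Finf (R : realType) (m n : nat) (S : lqr R m n)
    (K : 'M[R]_(m, n)) (x : 'cV[R]_n) : R :=
  fine (\sum_(0 <= i <oo) (closed_loop_cost S K x i)%:E)%E.

Definition Ftrunc (R : realType) (m n : nat) (S : lqr R m n) (h : nat)
    (K : 'M[R]_(m, n)) (x : 'cV[R]_n) : R :=
  \sum_(0 <= i < h) closed_loop_cost S K x i.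

Definition two_point (R : realType) (m n : nat)
    (Phi : 'M[R]_(m, n) -> 'cV[R]_n -> R) (alpha : R)
    (K : 'M[R]_(m, n)) (x : 'cV[R]_n) (U : 'M[R]_(m, n)) : 'M[R]_(m, n) :=
  ((m * n)%:R / (2 * alpha)
    * (Phi (K + alpha *: U) x - Phi (K - alpha *: U) x)) *: U.

Definition sub_sigma_algebra_of d (Omega : measurableType d)
    (F : set (set Omega)) : Prop :=
  sigma_algebra setT F /\ F `<=` measurable.

Definition measurable_wrt d' (Omega : Type) (T : measurableType d')
    (F : set (set Omega)) (X : Omega -> T) : Prop :=
  forall B : set T, measurable B -> F (X @^-1` B).

Definition sigma_of d' (Omega : Type) (T : measurableType d')
    (X : Omega -> T) : set (set Omega) :=
  preimage_set_system setT X measurable.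

Definition indep d (Omega : measurableType d) (R : realType)
    (P : probability Omega R) (F1 F2 : set (set Omega)) : Prop :=
  forall A B, F1 A -> F2 B -> P (A `&` B) = (P A * P B)%E.

Definition has_law d (Omega : measurableType d) (R : realType)
    (P : probability Omega R) (m n : nat) (X : Omega -> borel R m n)
    (D : probability (borel R m n) R) : Prop :=
  measurable_fun setT X /\
  forall B, measurable B -> P (X @^-1` B) = D B.

(* The uniform distribution on the unit sphere of R^{m x n} = R^{mn} is its
   unique Borel probability measure invariant under the orthogonal group
   O(mn). *)
Definition uniform_on_sphere d (Omega : measurableType d) (R : realType)
    (P : probability Omega R) (m n : nat) (U : Omega -> borel R m n) : Prop :=
  [/\ measurable_fun setT U,
      {ae P, forall w, fnorm (U w) = 1} &
      forall O : 'M[R]_(m * n), O *m O^T = 1%:M ->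
      forall B : set (borel R m n), measurable B ->
        P [set w | B (vec_mx (mxvec (U w) *m O))] = P (U @^-1` B)].

Record fresh_samples d (Omega : measurableType d) (R : realType) (m n : nat)
    (P : probability Omega R) (F : set (set Omega))
    (D : probability (borel R n 1) R)
    (x0 : Omega -> borel R n 1) (U : Omega -> borel R m n) : Prop := {
  fresh_x0_law : has_law P x0 D;
  fresh_U_law : uniform_on_sphere P U;
  fresh_x0_U : indep P (sigma_of x0) (sigma_of U);
  fresh_past : indep P F (sigma_of (fun w => (x0 w, U w))) }.

(* Y is a version of E[X | F]. *)
Definition cond_exp d (Omega : measurableType d) (R : realType)
    (P : probability Omega R) (F : set (set Omega)) (X Y : Omega -> R) : Prop :=
  [/\ P.-integrable setT (EFin \o X),
      P.-integrable setT (EFin \o Y),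
      measurable_wrt F Y &
      forall A, F A ->
        (\int[P]_(w in A) (Y w)%:E = \int[P]_(w in A) (X w)%:E)%E].

Definition cond_exp_mx d (Omega : measurableType d) (R : realType)
    (P : probability Omega R) (F : set (set Omega)) (m n : nat)
    (X Y : Omega -> 'M[R]_(m, n)) : Prop :=
  forall i j, cond_exp P F (fun w => X w i j) (fun w => Y w i j).

(* Versions of a conditional expectation agree almost surely, so an almost sure
   bound on one version is a bound on all of them. *)
Definition estimator_bounds d (Omega : measurableType d) (R : realType)
    (P : probability Omega R) (F : set (set Omega)) (m n : nat)
    (G g : Omega -> 'M[R]_(m, n)) (b V M delta : R) : Prop :=
  [/\ exists2 Y, cond_exp_mx P F G Y &
        {ae P, forall w, fnorm (Y w - g w) <= b},
      exists2 v, cond_exp P F (fun w => fnorm (G w) ^+ 2) v &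
        {ae P, forall w, v w <= V} &
      exists2 p, cond_exp P F (\1_[set w | fnorm (G w) <= M]) p &
        {ae P, forall w, 1 - delta <= p w}].

Definition admissible_policy d (Omega : measurableType d) (R : realType)
    (P : probability Omega R) (F : set (set Omega)) (m n : nat)
    (S : lqr R m n) (D : probability (borel R n 1) R) (fstar Delta : R)
    (K : Omega -> borel R m n) : Prop :=
  measurable_wrt F K /\ {ae P, forall w, (gap S D fstar (K w) <= Delta%:E)%E}.

Definition two_point_process d (Omega : measurableType d) (R : realType)
    (m n : nat) (Phi : 'M[R]_(m, n) -> 'cV[R]_n -> R) (alpha : R)
    (K : Omega -> borel R m n) (x0 : Omega -> borel R n 1)
    (U : Omega -> borel R m n) : Omega -> 'M[R]_(m, n) :=
  fun w => two_point Phi alpha (K w) (x0 w) (U w).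

Definition eps_h (R : realType) (m n : nat) (S : lqr R m n)
    (fstar DX Delta alpha : R) (h : nat) : R :=
  let f2 := fstar + 2 * Delta in
  (m * n)%:R * f2 * DX ^+ 2 / (2 * alpha)
    * (1 - lambda_min (costQ S) / f2) ^+ h.

(* Main.v *)
(** Write P_h(K) for the matrix of the h-step cost, so that F_h(K; x) = x^T P_h x.
    Since E[x_0 x_0^T] = I, the cost f(K) is the supremum of the traces tr P_h,
    and a positive semidefinite form satisfies x^T P x <= tr(P) |x|^2.  Hence
    F(K; x) <= c |x|^2 as soon as f(K) <= c, while the first stage costs at
    least lambda_min(Q) |x|^2 >= (lambda_min(Q) / c) F(K; x): along the closed
    loop F contracts by the factor 1 - lambda_min(Q) / c, which bounds the tail
    F - F_h.  With c = f_{2 Delta} the two estimators differ by at most eps_h,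
    almost surely, and this perturbation is carried through the three
    conditional bounds.  Conditional expectations exist by the Radon-Nikodym
    theorem for the restriction of P to the past. *)
Require Import Defs.
From HB Require Import structures.
From mathcomp Require Import all_boot all_order all_algebra.
From mathcomp Require Import all_classical all_reals all_analysis.
From mathcomp Require Import measurable_realfun ring lra.
Import Order.TTheory GRing.Theory Num.Theory.
Import numFieldNormedType.Exports.
Local Open Scope classical_set_scope.
Local Open Scope ring_scope.
Set Implicit Arguments.
Unset Strict Implicit.
Unset Printing Implicit Defensive.

(** * Norms and quadratic forms *)

Section frobenius.
Context {R : realType} {m n : nat}.
Implicit Types (a b : R) (M N : 'M[R]_(m, n)).

Lemma sqr_fnorm M : fnorm M ^+ 2 = \sum_i \sum_j M i j ^+ 2.
Proof.
rewrite sqr_sqrtr// !sumr_ge0// => i _.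
by rewrite sumr_ge0// => j _; rewrite sqr_ge0.
Qed.

Lemma fnorm_ge0 M : 0 <= fnorm M.
Proof. exact: sqrtr_ge0. Qed.

Lemma fdotxx M : fdot M M = fnorm M ^+ 2.
Proof. by rewrite sqr_fnorm. Qed.

Lemma fdotC M N : fdot M N = fdot N M.
Proof.
by apply: eq_bigr => i _; apply: eq_bigr => j _; rewrite mulrC.
Qed.

Lemma fdotZr a M N : fdot M (a *: N) = a * fdot M N.
Proof.
rewrite /fdot mulr_sumr; apply: eq_bigr => i _.
by rewrite mulr_sumr; apply: eq_bigr => j _; rewrite mxE mulrCA.
Qed.

Lemma fdotDr M N N' : fdot M (N + N') = fdot M N + fdot M N'.
Proof.
rewrite /fdot -big_split/=; apply: eq_bigr => i _.
by rewrite -big_split/=; apply: eq_bigr => j _; rewrite mxE mulrDr.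
Qed.

Lemma sqr_fnormD M N :
  fnorm (M + N) ^+ 2 = fnorm M ^+ 2 + 2 * fdot M N + fnorm N ^+ 2.
Proof.
by rewrite -!fdotxx fdotDr !(fdotC (M + N)) !fdotDr (fdotC N M); ring.
Qed.

Lemma fnormZ a M : fnorm (a *: M) = `|a| * fnorm M.
Proof.
apply/eqP; rewrite -(@eqrXn2 _ 2)// ?mulr_ge0 ?fnorm_ge0//.
rewrite exprMn -!fdotxx fdotZr fdotC fdotZr real_normK ?num_real//.
by rewrite mulrA expr2.
Qed.

Lemma fnorm0 : fnorm (0 : 'M[R]_(m, n)) = 0.
Proof. by rewrite -(scale0r (0 : 'M[R]_(m, n))) fnormZ normr0 mul0r. Qed.

Lemma fnormN M : fnorm (- M) = fnorm M.
Proof. by rewrite -scaleN1r fnormZ normrN1 mul1r. Qed.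

Lemma fnorm_eq0 M : (fnorm M == 0) = (M == 0).
Proof.
apply/idP/eqP => [/eqP M0|->]; last by rewrite fnorm0.
apply/matrixP => i j; rewrite mxE.
have /eqP := sqr_fnorm M; rewrite M0 expr0n/= eq_sym psumr_eq0; last first.
  by move=> k _; rewrite sumr_ge0// => l _; rewrite sqr_ge0.
move=> /allP/(_ i (mem_index_enum _)); rewrite psumr_eq0; last first.
  by move=> l _; rewrite sqr_ge0.
by move=> /allP/(_ j (mem_index_enum _)); rewrite /= sqrf_eq0 => /eqP.
Qed.

(** Cauchy-Schwarz: expand the square of the norm of [|N| M - |M| N] and divide by [|M| |N|], zero
    norms being treated apart. *)
Lemma fdot_le M N : fdot M N <= fnorm M * fnorm N.
Proof.
have [/eqP|M0] := eqVneq (fnorm M) 0.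
  rewrite fnorm_eq0 => /eqP->; rewrite fdotC -(scale0r (0 : 'M[R]_(m, n))).
  by rewrite fdotZr mul0r fnormZ normr0 !mul0r.
have [/eqP|N0] := eqVneq (fnorm N) 0.
  rewrite fnorm_eq0 => /eqP->; rewrite -(scale0r (0 : 'M[R]_(m, n))) fdotZr.
  by rewrite mul0r fnormZ normr0 mul0r mulr0.
have M1 : 0 < fnorm M by rewrite lt_neqAle eq_sym M0 fnorm_ge0.
have N1 : 0 < fnorm N by rewrite lt_neqAle eq_sym N0 fnorm_ge0.
have := sqr_ge0 (fnorm (fnorm N *: M - fnorm M *: N)).
rewrite sqr_fnormD fnormN -scaleNr !fdotZr fdotC fdotZr !fnormZ.
rewrite !ger0_norm ?fnorm_ge0// fdotC => h.
have : 0 <= (fnorm M * fnorm N) * (fnorm M * fnorm N - fdot M N) by nra.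
by rewrite pmulr_rge0 ?mulr_gt0// subr_ge0.
Qed.

Lemma fnormD M N : fnorm (M + N) <= fnorm M + fnorm N.
Proof.
rewrite -(@ler_pXn2r _ 2)// ?nnegrE ?addr_ge0 ?fnorm_ge0//.
by rewrite sqr_fnormD sqrrD -mulr_natl mulr_natl; have := fdot_le M N; nra.
Qed.

Lemma ler_norm_fnorm M i j : `|M i j| <= fnorm M.
Proof.
rewrite -(@ler_pXn2r _ 2)// ?nnegrE ?fnorm_ge0// real_normK ?num_real//.
rewrite sqr_fnorm (bigD1 i)//= (bigD1 j)//= -addrA lerDl addr_ge0//.
  by apply: sumr_ge0 => k _; rewrite sqr_ge0.
by apply: sumr_ge0 => k _; apply: sumr_ge0 => l _; rewrite sqr_ge0.
Qed.
End frobenius.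

Section quadratic_form.
Context {R : realType} {n : nat}.
Implicit Types (Q : 'M[R]_n) (x : 'cV[R]_n).

Definition psd Q := forall x, 0 <= qform Q x.

Lemma qformE Q x : qform Q x = \sum_i \sum_j x i 0 * x j 0 * Q i j.
Proof.
rewrite /qform mxE exchange_big; apply: eq_bigr => i _.
rewrite mxE mulr_suml; apply: eq_bigr => j _.
by rewrite mxE; ring.
Qed.

Lemma sqr_fnorm_cV x : fnorm x ^+ 2 = \sum_i x i 0 ^+ 2.
Proof. by rewrite sqr_fnorm; apply: eq_bigr => i _; rewrite big_ord1. Qed.

Lemma posdef_psd Q : posdef Q -> psd Q.
Proof.
move=> [_ Qpos] x; have [->|/Qpos/ltW//] := eqVneq x 0.
by rewrite /qform mulmx0 mxE.
Qed.

(* Summing [q(x_j e_i - x_i e_j) >= 0] over all pairs (i, j). *)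
Lemma qform_le_trace Q x : psd Q -> qform Q x <= \tr Q * fnorm x ^+ 2.
Proof.
move=> Qpsd.
have pair i j : 0 <= x j 0 ^+ 2 * Q i i + x i 0 ^+ 2 * Q j j
    - x i 0 * x j 0 * Q i j - x j 0 * x i 0 * Q j i.
  have := Qpsd (x j 0 *: delta_mx i 0 - x i 0 *: delta_mx j 0).
  rewrite /qform; set e := (X in 0 <= X -> _); set f := (X in _ -> 0 <= X).
  suff -> : e = f by [].
  pose del k : 'cV[R]_n := delta_mx k 0.
  have entry k l : ((del k)^T *m Q *m del l) 0 0 = Q k l.
    by rewrite trmx_delta -rowE -colE !mxE.
  rewrite /e /f [(_ - _)^T]linearB/=.
  rewrite [(x j 0 *: _)^T]linearZ [(x i 0 *: _)^T]linearZ/=.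
  rewrite mulmxBl mulmxBr !mulmxBl -!(scalemxAl, scalemxAr).
  have mxB (M N : 'M[R]_1) : (M - N) 0 0 = M 0 0 - N 0 0 by rewrite !mxE.
  have mxZ (a : R) (M : 'M[R]_1) : (a *: M) 0 0 = a * M 0 0 by rewrite mxE.
  rewrite !(mxB, mxZ, entry).
  by ring.
have : 0 <= \sum_i \sum_j (x j 0 ^+ 2 * Q i i + x i 0 ^+ 2 * Q j j
    - x i 0 * x j 0 * Q i j - x j 0 * x i 0 * Q j i).
  by apply: sumr_ge0 => i _; apply: sumr_ge0 => j _.
under eq_bigr do rewrite !big_split/= !sumrN -mulr_suml -mulr_sumr.
rewrite !big_split/= !sumrN -mulr_suml -mulr_sumr -qformE.
rewrite (exchange_big _ _ _ _ _ (fun i j => x j 0 * x i 0 * Q j i))/= -qformE.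
rewrite -sqr_fnorm_cV /mxtrace; lra.
Qed.

End quadratic_form.

(** * Properties stable under polynomial operations *)

Section polynomial_closure.
Context {R : realType} {T : Type}.

(** Continuity and measurability both have this form, so that one traversal of a matrix expression
    serves for the two. *)
Definition poly_closed (P : (T -> R) -> Prop) :=
  [/\ forall c, P (fun=> c),
      forall f g, P f -> P g -> P (fun t => f t + g t) &
      forall f g, P f -> P g -> P (fun t => f t * g t)].

Definition entries_in (P : (T -> R) -> Prop) (m n : nat)
    (M : T -> 'M[R]_(m, n)) :=
  forall i j, P (fun t => M t i j).

Variable P : (T -> R) -> Prop.
Hypothesis Pclosed : poly_closed P.

Lemma poly_closed_sum (I : Type) (r : seq I) (f : I -> T -> R) :
  (forall i, P (f i)) -> P (fun t => \sum_(i <- r) f i t).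
Proof.
case: Pclosed => Pc PD _ Pf; elim: r => [|i r ih].
  by under eq_fun do rewrite big_nil; exact: Pc.
by under eq_fun do rewrite big_cons; exact: PD.
Qed.

Lemma entries_in_cst (m n : nat) (M : 'M[R]_(m, n)) : entries_in P (fun=> M).
Proof. by case: Pclosed => Pc _ _ i j; exact: Pc. Qed.

Lemma entries_inZ (m n : nat) (a : T -> R) (M : T -> 'M[R]_(m, n)) :
  P a -> entries_in P M -> entries_in P (fun t => a t *: M t).
Proof.
case: Pclosed => _ _ PM Pa PN i j.
by under eq_fun do rewrite mxE; exact: PM.
Qed.

Lemma entries_inD (m n : nat) (M N : T -> 'M[R]_(m, n)) :
  entries_in P M -> entries_in P N -> entries_in P (fun t => M t + N t).
Proof.
case: Pclosed => _ PD _ PM PN i j.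
by under eq_fun do rewrite mxE; exact: PD.
Qed.

Lemma entries_inB (m n : nat) (M N : T -> 'M[R]_(m, n)) :
  entries_in P M -> entries_in P N -> entries_in P (fun t => M t - N t).
Proof.
move=> PM PN; apply: entries_inD => //.
under eq_fun do rewrite -scaleN1r.
by apply: entries_inZ => //; case: Pclosed.
Qed.

Lemma entries_in_tr (m n : nat) (M : T -> 'M[R]_(m, n)) :
  entries_in P M -> entries_in P (fun t => (M t)^T).
Proof. by move=> PM i j; under eq_fun do rewrite mxE; exact: PM. Qed.

Lemma entries_inM (m n p : nat)
    (M : T -> 'M[R]_(m, n)) (N : T -> 'M[R]_(n, p)) :
  entries_in P M -> entries_in P N -> entries_in P (fun t => M t *m N t).
Proof.
move=> PM PN i j; under eq_fun do rewrite mxE.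
by apply: poly_closed_sum => k; case: Pclosed => _ _; apply.
Qed.

Lemma entries_inX (n k : nat) (M : T -> 'M[R]_n) :
  entries_in P M -> entries_in P (fun t => M t ^+ k).
Proof.
move=> PM; elim: k => [|k ih].
  by under eq_fun do rewrite expr0; exact: entries_in_cst.
by under eq_fun do rewrite exprS; exact: entries_inM.
Qed.

End polynomial_closure.

Lemma poly_closed_continuous (R : realType) (V : topologicalType) :
  poly_closed (fun f : V -> R => continuous f).
Proof.
split=> [c|f g cf cg|f g cf cg] x.
- exact: cvg_cst.
- by apply: cvgD; [exact: cf|exact: cg].
- by apply: cvgM; [exact: cf|exact: cg].
Qed.

Lemma poly_closed_measurable (R : realType) d (V : measurableType d) :
  poly_closed (fun f : V -> R => measurable_fun setT f).
Proof.
split=> [c|f g cf cg|f g cf cg].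
- exact: measurable_cst.
- exact: measurable_funD.
- exact: measurable_funM.
Qed.

(** * Truncated costs *)

Section linear_quadratic.
Context {R : realType} {m n : nat}.
Variable S : lqr R m n.
Implicit Types (K : 'M[R]_(m, n)) (x : 'cV[R]_n).

Definition closed_loop K := sysA S - sysB S *m K.

(** Moving the closed loop into the matrix makes the stage cost a quadratic form in the initial
    state, whose mean depends on second moments only. *)
Definition stage_mx K i : 'M[R]_n := (closed_loop K ^+ i)^T *m
  (costQ S + K^T *m costR S *m K) *m closed_loop K ^+ i.

Lemma stage_mxE K x i : closed_loop_cost S K x i = qform (stage_mx K i) x.
Proof. by rewrite /closed_loop_cost /qform trmx_mul !mulmxA. Qed.

Lemma stateE K x i : state S K x i = closed_loop K ^+ i *m x.
Proof.
elim: i => [|i ih]; first by rewrite expr0 [RHS]mul1mx.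
rewrite [LHS]/= -/(state S K x i) ih /action mulNmx mulmxN.
by rewrite [sysB S *m _]mulmxA -mulmxBl -/(closed_loop K) mulmxA exprS.
Qed.

Lemma qform_state K x i :
  qform (costQ S) (state S K x i) + qform (costR S) (action K (state S K x i)) =
  closed_loop_cost S K x i.
Proof.
rewrite /closed_loop_cost -/(closed_loop K) -stateE.
set y := state S K x i; rewrite /qform /action mulNmx [(- _)^T]linearN/=.
rewrite trmx_mul mulmxDr mulmxDl [RHS]mxE; congr (_ + _).
by rewrite !mulNmx mulmxN opprK !mulmxA.
Qed.

(** [F_h] is a polynomial in the entries of the policy and of the state. Applied to continuity in
    the policy and to measurability of the estimator. *)
Lemma Ftrunc_closed T (P : (T -> R) -> Prop) h
    (k : T -> 'M[R]_(m, n)) (x : T -> 'cV[R]_n) :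
  poly_closed P -> entries_in P k -> entries_in P x ->
  P (fun t => Ftrunc S h (k t) (x t)).
Proof.
move=> Pc Pk Px; apply: poly_closed_sum => // i.
under eq_fun do rewrite stage_mxE.
have PX : entries_in P (fun t => closed_loop (k t) ^+ i).
  apply: entries_inX => //.
  apply: entries_inB => //; first exact: entries_in_cst.
  by apply: entries_inM => //; exact: entries_in_cst.
apply: (entries_inM Pc (entries_inM Pc (entries_in_tr Px) _) Px).
apply: entries_inM => //; apply: entries_inM => //; first exact: entries_in_tr.
apply: entries_inD => //; first exact: entries_in_cst.
apply: entries_inM => //; apply: entries_inM => //; last exact: entries_in_cst.
exact: entries_in_tr.
Qed.

(** Time invariance: after [a] stages the closed loop restarts from the state reached. *)
Lemma FtruncD K x a b :
  Ftrunc S (a + b) K x =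
  Ftrunc S a K x + Ftrunc S b K (closed_loop K ^+ a *m x).
Proof.
rewrite /Ftrunc /index_iota !subn0 iotaD big_cat/=; congr (_ + _).
rewrite -[X in iota X _]addn0 iotaDl big_map; apply: eq_bigr => i _.
by rewrite /closed_loop_cost -!/(closed_loop K) mulmxA addnC exprD.
Qed.

Hypotheses (hQ : posdef (costQ S)) (hR : posdef (costR S)).

Lemma stage_mx_psd K i : psd (stage_mx K i).
Proof.
move=> x; rewrite -stage_mxE -qform_state addr_ge0//; exact: posdef_psd.
Qed.

Lemma closed_loop_cost_ge0 K x i : 0 <= closed_loop_cost S K x i.
Proof. by rewrite stage_mxE; exact: stage_mx_psd. Qed.

Lemma Ftrunc_ge0 K x h : 0 <= Ftrunc S h K x.
Proof. by apply: sumr_ge0 => i _; exact: closed_loop_cost_ge0. Qed.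

(** The mean of [F_h] under an identity second moment. It is a real number for every policy, also
    where the cost may be infinite. *)
Definition trunc_trace h K := \sum_(0 <= i < h) \tr (stage_mx K i).

Lemma mxtrace_qform (Q : 'M[R]_n) : \tr Q = \sum_j qform Q (delta_mx j 0).
Proof.
apply: eq_bigr => j _; rewrite /qform trmx_delta -rowE -colE.
by rewrite !mxE.
Qed.

Lemma trunc_traceE h K : trunc_trace h K = \sum_j Ftrunc S h K (delta_mx j 0).
Proof.
rewrite exchange_big; apply: eq_bigr => i _.
by rewrite mxtrace_qform; apply: eq_bigr => j _; rewrite stage_mxE.
Qed.

Lemma Ftrunc_le_trace h K x :
  Ftrunc S h K x <= trunc_trace h K * fnorm x ^+ 2.
Proof.
rewrite mulr_suml; apply: ler_sum => i _.
by rewrite stage_mxE qform_le_trace//; exact: stage_mx_psd.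
Qed.

End linear_quadratic.

(** * Smallest eigenvalue and Rayleigh quotient *)

Section rayleigh.
Context {R : realType} {n : nat}.
Implicit Types (Q : 'M[R]_n) (x y : 'cV[R]_n).

Lemma qformZ a Q x : qform Q (a *: x) = a ^+ 2 * qform Q x.
Proof.
rewrite !qformE mulr_sumr; apply: eq_bigr => i _.
by rewrite mulr_sumr; apply: eq_bigr => j _; rewrite !mxE; ring.
Qed.

Lemma qformD Q x y : Q^T = Q ->
  qform Q (x + y) = qform Q x + 2 * (y^T *m Q *m x) 0 0 + qform Q y.
Proof.
move=> Qsym; rewrite /qform [(_ + _)^T]linearD/= mulmxDl mulmxDr !mulmxDl.
have mxD (M N : 'M[R]_1) : (M + N) 0 0 = M 0 0 + N 0 0 by rewrite mxE.
have -> : x^T *m Q *m y = (y^T *m Q *m x)^T.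
  by rewrite !trmx_mul trmxK Qsym mulmxA.
by rewrite !mxD [(_^T) 0 0]mxE; ring.
Qed.

Lemma qform_scalar_mx (a : R) x : qform a%:M x = a * fnorm x ^+ 2.
Proof.
rewrite /qform mul_mx_scalar -scalemxAl mxE sqr_fnorm_cV; congr (_ * _).
by rewrite mxE; apply: eq_bigr => i _; rewrite mxE expr2.
Qed.

Lemma qformBmx Q Q' x : qform (Q - Q') x = qform Q x - qform Q' x.
Proof. by rewrite /qform mulmxBr mulmxBl [LHS]mxE [X in _ + X]mxE. Qed.

(* A zero of a semidefinite form is a kernel vector: perturb it in the
   direction [- t Q x] with small [t > 0]. *)
Lemma psd_kernel Q x : Q^T = Q -> psd Q -> qform Q x = 0 -> Q *m x = 0.
Proof.
move=> Qsym Qpsd Qx0; apply/eqP; rewrite -fnorm_eq0 -sqrf_eq0.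
set y := Q *m x; set b := fnorm y ^+ 2; set c := qform Q y.
have c0 : 0 <= c by exact: Qpsd.
have b0 : 0 <= b by exact: sqr_ge0.
(* [b / (c + 1)] replaces the minimizing step [b / c], the added 1 covering [c = 0]. The form takes
   there a negative multiple of [b ^+ 2], which forces [b = 0]. *)
have : 0 <= qform Q (x + - (b / (c + 1)) *: y) by exact: Qpsd.
have -> : qform Q (x + - (b / (c + 1)) *: y)
    = - (b / (c + 1)) * (2 * b) + (b / (c + 1)) ^+ 2 * c.
  rewrite qformD// Qx0 add0r qformZ sqrrN -/c; congr (_ + _).
  rewrite [(_ *: _)^T]linearZ/= -!scalemxAl mxE -mulmxA -/y.
  suff -> : (y^T *m y) 0 0 = b by ring.
  by have := qform_scalar_mx 1 y; rewrite /qform mulmx1 mul1r.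
have -> : - (b / (c + 1)) * (2 * b) + (b / (c + 1)) ^+ 2 * c =
  - (b ^+ 2 * ((c + 2) / (c + 1) ^+ 2)) by field; rewrite gt_eqF// ltr_wpDl.
rewrite oppr_ge0 pmulr_lle0; last by apply: divr_gt0; nra.
by rewrite le_eqVlt ltNge sqr_ge0 orbF sqrf_eq0.
Qed.

Lemma continuous_coord_sum (g : 'I_n -> 'I_n -> R) :
  continuous (fun v : 'rV[R]_n => \sum_i \sum_j v 0 i * v 0 j * g i j).
Proof.
have Pcl := @poly_closed_continuous R 'rV[R]_n; have [Pc _ PM] := Pcl.
apply: (poly_closed_sum Pcl) => i; apply: (poly_closed_sum Pcl) => j.
apply: (PM (fun v => v 0 i * v 0 j)); last exact: Pc.
by apply: (PM (fun v => v 0 i)) => w; exact: coord_continuous.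
Qed.

Lemma qform_trE Q (v : 'rV[R]_n) :
  qform Q v^T = \sum_i \sum_j v 0 i * v 0 j * Q i j.
Proof.
by rewrite qformE; apply: eq_bigr => i _; apply: eq_bigr => j _; rewrite !mxE.
Qed.

Lemma eigenvalue_posdef_ge0 Q a : posdef Q -> eigenvalue Q a -> 0 <= a.
Proof.
move=> [_ Qgt0] /eigenvalueP[v vQ v0].
have v0' : v^T != 0.
  by apply: contra v0 => /eqP/(congr1 trmx); rewrite trmxK trmx0 => ->.
have := ltW (Qgt0 _ v0'); rewrite /qform trmxK vQ -scalemxAl mxE.
have := qform_scalar_mx 1 v^T; rewrite /qform trmxK mulmx1 mul1r => ->.
by rewrite pmulr_lge0// exprn_gt0// lt_neqAle eq_sym fnorm_ge0 fnorm_eq0 v0'.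
Qed.

(** The form attains a minimum [a] on the compact unit sphere. Then [Q - a] is semidefinite and
    vanishes at the minimizer, which is therefore an eigenvector for [a], and the infimum of the
    eigenvalues is at most [a]. *)
Lemma lambda_min_le Q x : posdef Q ->
  lambda_min Q * fnorm x ^+ 2 <= qform Q x.
Proof.
move=> Qpos; have [Qsym Qgt0] := Qpos.
have [->|x0] := eqVneq x 0.
  by rewrite fnorm0 expr0n/= mulr0; exact: posdef_psd.
have nx0 : 0 < fnorm x by rewrite lt_neqAle eq_sym fnorm_eq0 x0 fnorm_ge0.
(* Row vectors suit the extreme value theorem applied below; [s] is the squared Euclidean norm
   written as a form, hence a polynomial. *)
pose f (v : 'rV[R]_n) := qform Q v^T.
pose s (v : 'rV[R]_n) := qform 1%:M v^T.
have sE v : s v = fnorm v^T ^+ 2 by rewrite /s qform_scalar_mx mul1r.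
have cf : continuous f.
  rewrite (_ : f = fun v => \sum_i \sum_j v 0 i * v 0 j * Q i j).
    exact: continuous_coord_sum.
  by apply/funext => v; exact: qform_trE.
have cs : continuous s.
  rewrite (_ : s = fun v => \sum_i \sum_j v 0 i * v 0 j * (1%:M : 'M[R]_n) i j).
    exact: continuous_coord_sum.
  by apply/funext => v; exact: qform_trE.
pose A := [set v : 'rV[R]_n | s v = 1].
have A0 : A !=set0.
  exists ((fnorm x)^-1 *: x)^T; rewrite /A /= sE trmxK fnormZ.
  by rewrite ger0_norm ?invr_ge0 ?fnorm_ge0// mulVf ?expr1n// gt_eqF.
have cA : compact A.
  apply: bounded_closed_compact.
    exists 1; split; first exact: num_real.
    move=> M M1 v Av; rewrite /= (le_trans _ (ltW M1))//.
    rewrite /Num.norm/= mx_normrE; apply/bigmax_leP; split => // -[i j] _ /=.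
    have := ler_norm_fnorm v^T j i; rewrite mxE => /le_trans; apply.
    rewrite -(@ler_pXn2r _ 2)// ?nnegrE ?fnorm_ge0//.
    by rewrite -sE expr1n (Av : s v = 1).
  rewrite (_ : A = s @^-1` [set 1]); last by [].
  by apply: preimage_closed => //; exact: closed_eq.
have [c Ac minc] := EVT_min_rV A0 cA (continuous_subspaceT cf).
move: Ac; rewrite inE => Ac.
have nc1 : fnorm c^T ^+ 2 = 1 by rewrite -sE.
pose a := f c.
have lea y : a * fnorm y ^+ 2 <= qform Q y.
  have [->|y0] := eqVneq y 0.
    by rewrite fnorm0 expr0n/= mulr0; exact: posdef_psd.
  have ny0 : 0 < fnorm y by rewrite lt_neqAle eq_sym fnorm_eq0 y0 fnorm_ge0.
  have /minc : ((fnorm y)^-1 *: y)^T \in A.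
    rewrite inE /A /= sE trmxK fnormZ.
    by rewrite ger0_norm ?invr_ge0 ?fnorm_ge0// mulVf ?expr1n// gt_eqF.
  by rewrite -/a /f trmxK qformZ exprVn mulrC ler_pdivlMr ?exprn_gt0.
have Ea : eigenvalue Q a.
  apply/eigenvalueP; exists c; last first.
    by apply/eqP => c0; move: nc1; rewrite c0 trmx0 fnorm0; lra.
  have sym' : (Q - a%:M)^T = Q - a%:M by rewrite linearB/= Qsym tr_scalar_mx.
  have : (Q - a%:M) *m c^T = 0.
    apply: psd_kernel => // [y|]; rewrite qformBmx qform_scalar_mx.
      by rewrite subr_ge0.
    by rewrite nc1 mulr1 subrr.
  move=> /(congr1 trmx); rewrite trmx_mul trmxK sym' trmx0.
  by rewrite mulmxBr mul_mx_scalar => /eqP; rewrite subr_eq0 => /eqP.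
rewrite (le_trans _ (lea x))// ler_wpM2r ?sqr_ge0//.
by apply: ge_inf => //; exists 0 => e; exact: eigenvalue_posdef_ge0.
Qed.

Lemma lambda_min_ge0 Q : posdef Q -> 0 <= lambda_min Q.
Proof.
rewrite /lambda_min => Qpos.
(* Without an infimum, as for [n = 0] where there is no eigenvalue, [inf] has the default value
   0. *)
have [[E0 _]|/inf_out->//] := pselect (has_inf [set a | eigenvalue Q a]).
by apply: lb_le_inf => // e; exact: eigenvalue_posdef_ge0.
Qed.
End rayleigh.

(** * Measurability, and the cost as a series of traces *)

Lemma measurable_entry (R : realType) (m n : nat) (i : 'I_m) (j : 'I_n) :
  measurable_fun setT (fun M : borel R m n => (M : 'M[R]_(m, n)) i j).
Proof.
apply: (measurability _ (RGenOpens.measurableE R)) => _ [_ [a [b ->] <-]].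
rewrite setTI; apply: sub_sigma_algebra; apply: open_comp => [M _|].
  exact: coord_continuous.
exact: interval_open.
Qed.

Lemma le_integrable_ae d (T : measurableType d) (R : realType)
    (mu : {measure set T -> \bar R}) (f g : T -> \bar R) :
  measurable_fun setT f -> {ae mu, forall x, `|f x| <= `|g x|}%E ->
  mu.-integrable setT g -> mu.-integrable setT f.
Proof.
move=> mf fg /integrableP[mg ?]; apply/integrableP; split => //.
apply: le_lt_trans; last eassumption.
apply: ae_ge0_le_integral => //; try exact: measurableT_comp.
by apply: filterS fg.
Qed.

Section cost.
Context {R : realType} {m n : nat}.
Variables (S : lqr R m n) (D : probability (borel R n 1) R) (DX : R).
Hypotheses (hQ : posdef (costQ S)) (hR : posdef (costR S)).
Hypothesis hD : state_law D DX.

Lemma measurable_qform (Q : 'M[R]_n) :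
  measurable_fun setT (fun x : borel R n 1 => qform Q x).
Proof.
under eq_fun do rewrite qformE.
have Pcl := @poly_closed_measurable R _ (borel R n 1).
apply: (poly_closed_sum Pcl) => i; apply: (poly_closed_sum Pcl) => j.
apply: measurable_funM; last exact: measurable_cst.
by apply: measurable_funM; exact: measurable_entry.
Qed.

(** The almost sure bound on the state makes the products [x_i x_j] integrable; the identity second
    moment then keeps only the diagonal of [Q]. *)
Lemma integral_qform (Q : 'M[R]_n) :
  (\int[D]_x (qform Q (x : 'cV[R]_n))%:E = (\tr Q)%:E)%E.
Proof.
have [mom bnd] := hD.
have meas i j : measurable_fun setT
    (fun x : borel R n 1 => (x : 'cV[R]_n) i 0 * (x : 'cV[R]_n) j 0).
  by apply: measurable_funM; exact: measurable_entry.
have intg i j : D.-integrable setT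
    (fun x : borel R n 1 => ((x : 'cV[R]_n) i 0 * (x : 'cV[R]_n) j 0)%:E).
  apply: (@le_integrable_ae _ _ _ _ _ (cst (DX ^+ 2)%:E)).
  - exact/measurable_EFinP.
  - have F : Filter (almost_everywhere D) by apply: ae_filter_ringOfSetsType.
    apply: filterS bnd => x /= xDX; rewrite lee_fin normrM.
    rewrite (ger0_norm (sqr_ge0 DX)) expr2.
    by apply: ler_pM => //; exact: le_trans (ler_norm_fnorm _ _ _) xDX.
  - exact: finite_measure_integrable_cst.
under eq_integral => x _.
  rewrite qformE -sumEFin.
  under eq_bigr do (rewrite -sumEFin; under eq_bigr do rewrite mulrC EFinM).
  over.
rewrite integral_sum//; last first.
  by move=> i; apply: integrable_sum => // j _; exact: integrableZl.
under eq_bigr => i _.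
  rewrite integral_sum//; last by move=> j; exact: integrableZl.
  under eq_bigr => j _ do rewrite integralZl// mom mxE -EFinM.
  rewrite sumEFin (bigD1 i)//= eqxx mulr1 big1 ?addr0; last first.
    by move=> j ji; rewrite eq_sym (negbTE ji) mulr0.
  over.
by rewrite sumEFin.
Qed.

(** Stage costs are nonnegative, so integral and series may be exchanged even when the value is
    infinite. *)
Lemma costE K : cost S D K = (\sum_(0 <= i <oo) (\tr (stage_mx S K i))%:E)%E.
Proof.
rewrite /cost.
under eq_integral => x _.
  under eq_eseriesr do rewrite qform_state stage_mxE.
  over.
rewrite integral_nneseries//.
- by under eq_eseriesr do rewrite integral_qform.
- by move=> i; apply/measurable_EFinP; exact: measurable_qform.
- by move=> i x _; rewrite lee_fin; exact: stage_mx_psd.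
Qed.

Lemma stage_trace_ge0 K i : 0 <= \tr (stage_mx S K i).
Proof.
by rewrite mxtrace_qform; apply: sumr_ge0 => j _; exact: stage_mx_psd.
Qed.

Lemma cost_ge0 K : (0 <= cost S D K)%E.
Proof.
rewrite costE; apply: nneseries_ge0 => i _ _.
by rewrite lee_fin stage_trace_ge0.
Qed.

(** Trades the extended-valued cost for real inequalities on partial sums, which increase because
    traces of semidefinite forms are nonnegative. *)
Lemma cost_leP K c :
  (cost S D K <= c%:E)%E <-> forall h, trunc_trace S h K <= c.
Proof.
rewrite costE; split=> [Kc h|Kc].
  rewrite -lee_fin (le_trans _ Kc)// /trunc_trace -sumEFin.
  by apply: nneseries_lim_ge => i _ _; rewrite lee_fin stage_trace_ge0.
apply: lime_le.
  by apply: is_cvg_nneseries => i _ _; rewrite lee_fin stage_trace_ge0.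
by near=> h; rewrite sumEFin lee_fin; exact: Kc.
Unshelve. all: by end_near. Qed.

End cost.

(** * Geometric decay of the tail *)

Section truncation.
Context {R : realType} {m n : nat}.
Variable S : lqr R m n.
Hypotheses (hQ : posdef (costQ S)) (hR : posdef (costR S)).
Variables (K : 'M[R]_(m, n)) (c : R).
Hypothesis trc : forall h, trunc_trace S h K <= c.
Implicit Type x : 'cV[R]_n.

Lemma Ftrunc_le_mul h x : Ftrunc S h K x <= c * fnorm x ^+ 2.
Proof.
by rewrite (le_trans (Ftrunc_le_trace hQ hR _ _ _))// ler_wpM2r// sqr_ge0.
Qed.

(** Partial sums stay below [c |x|^2], so the series is finite and the default value in [Finf] does
    not occur. *)
Lemma Finf_fin_num x :
  (\sum_(0 <= i <oo) (closed_loop_cost S K x i)%:E)%E = (Finf S K x)%:E.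
Proof.
rewrite /Finf fineK// ge0_fin_numE; last first.
  by apply: nneseries_ge0 => i _ _; rewrite lee_fin closed_loop_cost_ge0.
apply: (@le_lt_trans _ _ (c * fnorm x ^+ 2)%:E); last exact: ltry.
apply: lime_le.
  by apply: is_cvg_nneseries => i _ _; rewrite lee_fin closed_loop_cost_ge0.
by near=> h; rewrite sumEFin lee_fin; exact: Ftrunc_le_mul.
Unshelve. all: by end_near. Qed.

Lemma Ftrunc_le_Finf h x : Ftrunc S h K x <= Finf S K x.
Proof.
rewrite -lee_fin -Finf_fin_num /Ftrunc -sumEFin.
by apply: nneseries_lim_ge => i _ _; rewrite lee_fin closed_loop_cost_ge0.
Qed.

Lemma Finf_le x b : (forall h, Ftrunc S h K x <= b) -> Finf S K x <= b.
Proof.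
move=> Fb; rewrite -lee_fin -Finf_fin_num; apply: lime_le.
  by apply: is_cvg_nneseries => i _ _; rewrite lee_fin closed_loop_cost_ge0.
by near=> h; rewrite sumEFin lee_fin; exact: Fb.
Unshelve. all: by end_near. Qed.

(** Bellman recursion: pass to the limit in [FtruncD], bounding partial sums by the total in both
    directions. *)
Lemma FinfE h x :
  Finf S K x = Ftrunc S h K x + Finf S K (closed_loop S K ^+ h *m x).
Proof.
apply/le_anti/andP; split.
  apply: Finf_le => k.
  rewrite (@le_trans _ _ (Ftrunc S (h + k) K x))//; last first.
    by rewrite FtruncD lerD2l Ftrunc_le_Finf.
  by rewrite addnC FtruncD lerDl Ftrunc_ge0.
rewrite addrC -lerBrDr; apply: Finf_le => k.
by rewrite lerBrDr addrC -FtruncD Ftrunc_le_Finf.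
Qed.

Hypothesis c0 : 0 < c.
Let rho := 1 - lambda_min (costQ S) / c.

Lemma stage_cost_ge x : lambda_min (costQ S) * fnorm x ^+ 2 <= Ftrunc S 1 K x.
Proof.
rewrite (le_trans (lambda_min_le _ hQ))// /Ftrunc big_nat1 -qform_state.
by rewrite stateE expr0 mul1mx lerDl posdef_psd.
Qed.

(* [n > 0] gives a unit vector [e], and then
   [lambda_min <= F_1(e) <= c |e|^2 = c]. *)
Lemma contraction_ge0 : (0 < n)%N -> 0 <= rho.
Proof.
move=> n0; rewrite subr_ge0 ler_pdivrMr// mul1r.
pose e : 'cV[R]_n := delta_mx (Ordinal n0) 0.
have e1 : fnorm e ^+ 2 = 1.
  rewrite sqr_fnorm_cV (bigD1 (Ordinal n0))//= mxE !eqxx expr1n big1 ?addr0//.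
  by move=> i /negbTE ie; rewrite mxE ie expr0n.
by have := le_trans (stage_cost_ge e) (Ftrunc_le_mul 1 e); rewrite e1 !mulr1.
Qed.

(** Since [F <= c |x|^2], the first stage takes away at least the fraction [lambda_min / c] of the
    total cost, and the recursion leaves the rest to the next state. *)
Lemma Finf_contraction x :
  Finf S K (closed_loop S K *m x) <= rho * Finf S K x.
Proof.
have := FinfE 1 x; rewrite expr1 => Fx.
have : lambda_min (costQ S) / c * Finf S K x <= Ftrunc S 1 K x.
  rewrite (le_trans _ (stage_cost_ge x))// -mulrA ler_wpM2l ?lambda_min_ge0//.
  rewrite mulrC ler_pdivrMr// mulrC.
  by apply: Finf_le => h; exact: Ftrunc_le_mul.
by rewrite /rho mulrBl mul1r {2}Fx; lra.
Qed.

(** The recursion identifies the tail with the cost from the state at time [h], reached through [h]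
    contractions. The lower bound 0 serves when two tails are subtracted. *)
Lemma Finf_tail h x : (0 < n)%N ->
  0 <= Finf S K x - Ftrunc S h K x <= c * fnorm x ^+ 2 * rho ^+ h.
Proof.
move=> n0; rewrite subr_ge0 Ftrunc_le_Finf/= lerBlDl (FinfE h) lerD2l.
elim: h => [|h ih].
  by rewrite expr0 mul1mx mulr1; apply: Finf_le => h; exact: Ftrunc_le_mul.
(* The new factor is split off on the left, so that the contraction acts on the state at time [h];
   [rho >= 0] lets the induction hypothesis be multiplied by [rho]. *)
rewrite [closed_loop S K ^+ h.+1]exprS [rho ^+ h.+1]exprS -mulmxA.
rewrite (le_trans (Finf_contraction _))// mulrCA.
by apply: ler_wpM2l => //; exact: contraction_ge0.
Qed.

End truncation.

(** * Policies near a sublevel set *)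

Section double_sublevel.
Context {R : realType} {m n : nat}.
Variables (S : lqr R m n) (D : probability (borel R n 1) R) (DX : R).
Hypotheses (hQ : posdef (costQ S)) (hR : posdef (costR S)).
Hypothesis hD : state_law D DX.
Variable fstar : R.

Lemma trunc_trace_continuous h (K G : 'M[R]_(m, n)) :
  continuous (fun s : R => trunc_trace S h (K - s *: G)).
Proof.
have Pcl := @poly_closed_continuous R R.
under eq_fun do rewrite trunc_traceE.
apply: (poly_closed_sum Pcl) => j.
apply: (Ftrunc_closed S h Pcl); last exact: entries_in_cst.
apply: entries_inB => //; first exact: entries_in_cst.
apply: entries_inZ => //; first by move=> x; exact: cvg_id.
exact: entries_in_cst.
Qed.

(* On the boundary [gap K = Delta] the radius property is not available at K
   itself.  By gradient domination K is not critical, so a short gradient step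
   enters the open sublevel set; translate K' along with K and let the step
   tend to 0, using that the truncated costs are continuous. *)
Lemma trunc_trace_double_sublevel (mu Delta r L' r' : R) K K' :
  0 < mu -> 0 < Delta ->
  smoothness_constants S D fstar mu (Delta + 1) L' r' ->
  radius_in_double_sublevel S D fstar Delta r ->
  (gap S D fstar K <= Delta%:E)%E -> fnorm (K' - K) <= r ->
  forall h, trunc_trace S h K' <= fstar + 2 * Delta.
Proof.
move=> mu0 Delta0 [L'0 r'0 smooth] rad gapK K'K h.
have [gapK1|] := boolP (gap S D fstar K < Delta%:E)%E.
  by have /(cost_leP hQ hR hD) := rad _ _ gapK1 K'K; exact.
rewrite -leNgt => Kgap.
have {gapK Kgap}gapE : gap S D fstar K = Delta%:E.
  by apply/le_anti; rewrite gapK.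
have costK : cost S D K = (fstar + Delta)%:E.
  move: gapE; rewrite /gap; have := cost_ge0 hQ hR hD K.
  case: (cost S D K) => //= f _ [] /eqP; rewrite subr_eq => /eqP ->.
  by rewrite addrC.
(* [K] lies strictly inside the sublevel set of level [Delta + 1], so the constants of that level
   apply to it. *)
have [|step /andP[gd _]] := smooth K; first by rewrite gapE lte_fin ltrDl.
move: gd step; set g := grad_cost S D K; rewrite gapE /= costK /= => gd step.
have g2 : 0 < fnorm g ^+ 2 by rewrite (lt_le_trans _ gd)// mulr_gt0.
have g0 : 0 < fnorm g.
  rewrite lt_neqAle fnorm_ge0 andbT.
  by apply: contraTneq g2 => <-; rewrite expr0n ltxx.
have near0 : \forall s \near (0 : R)^'+,
    trunc_trace S h (K' - s *: g) <= fstar + 2 * Delta.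
  near=> s.
  have s0 : 0 < s by near: s; exact: nbhs_right_gt.
  (* This bound keeps the step within the radius [r']; the next one makes the descent strict. *)
  have sr : s <= r' / fnorm g.
    by near: s; apply: nbhs_right_le; rewrite divr_gt0.
  have sL : s < 2 / L' by near: s; apply: nbhs_right_lt; rewrite divr_gt0.
  suff /(cost_leP hQ hR hD) :
    (cost S D (K' - s *: g) <= (fstar + 2 * Delta)%:E)%E by exact.
  apply: (rad (K - s *: g)); last first.
    suff -> : K' - s *: g - (K - s *: g) = K' - K by [].
    by rewrite opprB addrA subrK.
  have KsK : K - s *: g - K = - (s *: g) by rewrite addrC addKr.
  have [|_ le1] := step (K - s *: g).
    by rewrite KsK fnormN fnormZ gtr0_norm// -ler_pdivlMr.
  (* Descent: [f(K - s g) <= f(K) - s |g|^2 (1 - L' s / 2) < f(K)], so the gap falls strictly below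
     [Delta]. *)
  rewrite /gap lteBlDr// -EFinD; apply: le_lt_trans le1 _; rewrite lte_fin.
  have KKs : K - (K - s *: g) = s *: g by rewrite opprB addrC subrK.
  rewrite KsK KKs -scaleNr fdotZr fdotxx fnormZ gtr0_norm// exprMn.
  rewrite -addrA [Delta + _]addrC gtrDl.
  rewrite (_ : _ + _ = - (s * fnorm g ^+ 2 * (1 - L' / 2 * s))); last by lra.
  rewrite oppr_lt0 !mulr_gt0// subr_gt0 mulrC -ltr_pdivlMr ?divr_gt0//.
  by rewrite mul1r invf_div.
(* The bound holds for all small [s > 0], and a non-strict inequality passes to the limit
   [s = 0]. *)
have lim0 := cvg_at_right_filter (@trunc_trace_continuous h K' g 0).
have := cvgr_to_le lim0 near0.
by rewrite scale0r subr0; apply.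
Unshelve. all: by end_near. Qed.

End double_sublevel.

(** * Truncation error of the two-point estimator *)

Section estimator.
Context {R : realType} {m n : nat}.
Variable S : lqr R m n.
Hypotheses (hQ : posdef (costQ S)) (hR : posdef (costR S)).
Variables (fstar DX Delta alpha : R) (h : nat).
Hypothesis f2 : 0 < fstar + 2 * Delta.
Hypothesis alpha0 : 0 < alpha.

(** Both truncation errors lie between 0 and the same tail bound, so their difference is at most one
    tail and not two; the factor [d / (2 alpha)] then gives exactly [eps_h]. *)
Lemma two_point_truncation (K U : 'M[R]_(m, n)) (x : 'cV[R]_n) :
  fnorm x <= DX -> fnorm U = 1 ->
  (forall V, fnorm V <= alpha ->
     forall h, trunc_trace S h (K + V) <= fstar + 2 * Delta) ->
  fnorm (two_point (Ftrunc S h) alpha K x U - two_point (Finf S) alpha K x U)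
    <= eps_h S fstar DX Delta alpha h.
Proof.
move=> xDX U1 tr.
(* A matrix without columns has norm 0, so [U] of norm 1 excludes [n = 0]. *)
have n0 : (0 < n)%N.
  rewrite lt0n; apply/eqP => n0; move: U1; apply/eqP.
  rewrite /fnorm big1 ?sqrtr0 1?eq_sym ?oner_eq0//.
  by move=> i _; rewrite big1// => j; have := ltn_ord j; rewrite {2}n0.
have tail V : fnorm V <= alpha ->
    0 <= Finf S (K + V) x - Ftrunc S h (K + V) x <=
      (fstar + 2 * Delta) * DX ^+ 2 *
      (1 - lambda_min (costQ S) / (fstar + 2 * Delta)) ^+ h.
  move=> /tr trV; have /andP[-> /= le1] := Finf_tail hQ hR trV f2 h x n0.
  rewrite (le_trans le1)// ler_wpM2r//.
    by rewrite exprn_ge0// (contraction_ge0 hQ hR trV).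
  apply: ler_wpM2l; first exact: ltW.
  by rewrite ler_pXn2r ?nnegrE ?fnorm_ge0// (le_trans _ xDX) ?fnorm_ge0.
have aU : fnorm (alpha *: U) = alpha by rewrite fnormZ U1 mulr1 gtr0_norm.
have /tail/andP[p1 p2] : fnorm (alpha *: U) <= alpha by rewrite aU.
have /tail/andP[q1 q2] : fnorm (- (alpha *: U)) <= alpha by rewrite fnormN aU.
rewrite /two_point -scalerBl fnormZ U1 mulr1 -mulrBr normrM.
rewrite ger0_norm; last by rewrite divr_ge0// mulr_ge0// ltW.
rewrite /eps_h.
set c := (m * n)%:R; set f := fstar + _ in p2 q2 *; set e := _ ^+ h in p2 q2 *.
rewrite (_ : _ * _ * e = c / (2 * alpha) * (f * DX ^+ 2 * e)); last by ring.
apply: ler_wpM2l; first by rewrite divr_ge0 ?mulr_ge0// ltW.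
by rewrite ler_norml; apply/andP; split; lra.
Qed.

End estimator.

(** * Conditional expectation *)

(** The difference is integrated through its absolute value: the two agree almost everywhere, and
    the latter is nonnegative everywhere. *)
Lemma le_integral_ae d (T : measurableType d) (R : realType)
    (mu : {measure set T -> \bar R}) (A : set T) (f g : T -> R) :
  measurable A ->
  mu.-integrable setT (EFin \o f) -> mu.-integrable setT (EFin \o g) ->
  {ae mu, forall x, f x <= g x} ->
  (\int[mu]_(x in A) (f x)%:E <= \int[mu]_(x in A) (g x)%:E)%E.
Proof.
move=> mA i_f i_g fg.
have FF : Filter (almost_everywhere mu) by apply: ae_filter_ringOfSetsType.
have iA h : mu.-integrable setT (EFin \o h) -> mu.-integrable A (EFin \o h).
  exact: integrableS.
rewrite -sube_ge0; last by rewrite integrable_fin_num//; exact: iA.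
rewrite -integralB//; [|exact: iA..].
have mB : measurable_fun A (fun x => (g x)%:E - (f x)%:E)%E.
  by apply: emeasurable_funB; apply: measurable_int; exact: iA.
rewrite (ae_eq_integral (fun x => `|(g x)%:E - (f x)%:E|)%E)//.
- exact: integral_ge0.
- exact: measurableT_comp.
- by apply: filterS fg => x fgx _; rewrite gee0_abs// -EFinB lee_fin subr_ge0.
Qed.

Section conditional_expectation.
Context {d : measure_display} {Omega : measurableType d} {R : realType}.
Variables (P : probability Omega R) (F : set (set Omega)).
Hypothesis hF : sub_sigma_algebra_of F.
Implicit Types X Y v : Omega -> R.

(** [Omega] carrying the past as its sigma-algebra: measurability with respect to [F] becomes
    measurability on this space. *)
Local Notation coarse := (g_sigma_algebraType F).

Lemma coarse_measurableE : @measurable _ coarse = F.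
Proof. by apply: sigma_algebra_id; case: hF. Qed.

Lemma measurable_wrtP d' (T : measurableType d') (X : Omega -> T) :
  measurable_wrt F X <-> measurable_fun setT (X : coarse -> T).
Proof.
split=> [mX _ B mB|mX B mB].
  by rewrite setTI coarse_measurableE; exact: mX.
by rewrite -coarse_measurableE -[X in measurable X]setTI; exact: mX.
Qed.

Lemma measurable_wrtW d' (T : measurableType d') (X : Omega -> T) :
  measurable_wrt F X -> measurable_fun setT X.
Proof. by move=> mX _ B mB; rewrite setTI; apply: hF.2; exact: mX. Qed.

Lemma measurable_id_coarse : measurable_fun setT (id : Omega -> coarse).
Proof.
by move=> _ B; rewrite coarse_measurableE setTI preimage_id => /hF.2.
Qed.

(** Test on the event [v1 > v2], which belongs to [F]: a positive difference has integral at most 0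
    over it, so the event is null. *)
Lemma ae_le_sub_sigma (v1 v2 : Omega -> R) :
  P.-integrable setT (EFin \o v1) -> P.-integrable setT (EFin \o v2) ->
  measurable_wrt F v1 -> measurable_wrt F v2 ->
  (forall A, F A ->
    (\int[P]_(w in A) (v1 w)%:E <= \int[P]_(w in A) (v2 w)%:E)%E) ->
  {ae P, forall w, v1 w <= v2 w}.
Proof.
move=> i1 i2 m1 m2 le12.
have FF : Filter (almost_everywhere P) by apply: ae_filter_ringOfSetsType.
pose A := (fun w => v1 w - v2 w) @^-1` `]0, +oo[%classic.
have FA : F A.
  suff /measurable_wrtP :
      measurable_fun setT ((fun w => v1 w - v2 w) : coarse -> R).
    by apply; exact: measurable_itv.
  by apply: measurable_funB; exact/measurable_wrtP.
have mA : measurable A by exact: hF.2.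
have iA v : P.-integrable setT (EFin \o v) -> P.-integrable A (EFin \o v).
  exact: integrableS.
have AE w : A w -> 0 < v1 w - v2 w by rewrite /A /= in_itv/= andbT.
have : ae_eq P A (fun w => (v1 w - v2 w)%:E) (cst 0%E).
  apply/ae_eq_integral_abs => //.
    apply: measurable_funTS; apply/measurable_EFinP; apply: measurable_funB;
    exact: measurable_wrtW.
  apply/le_anti/andP; split; last exact: integral_ge0.
  rewrite (eq_integral (fun w => (v1 w)%:E - (v2 w)%:E)%E); last first.
    by move=> w; rewrite inE => /AE vw; rewrite gee0_abs ?lee_fin ?ltW// EFinB.
  rewrite integralB//; [|exact: iA..].
  by rewrite sube_le0 le12.
apply: filterS => w /= vA; rewrite leNgt; apply/negP => v21.
have Aw : A w by rewrite /A /= in_itv/= andbT subr_gt0.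
by have [] := vA Aw; have := AE _ Aw; lra.
Qed.

Lemma cond_exp_ae_le X1 X2 v1 v2 :
  cond_exp P F X1 v1 -> cond_exp P F X2 v2 ->
  {ae P, forall w, X1 w <= X2 w} -> {ae P, forall w, v1 w <= v2 w}.
Proof.
move=> [i1 j1 m1 E1] [i2 j2 m2 E2] X12; apply: ae_le_sub_sigma => // A FA.
by rewrite E1// E2// le_integral_ae//; exact: hF.2.
Qed.

(** The charge sending [A] to the integral of [X] over [A], restricted to [F], is dominated by the
    restriction of [P]; its Radon-Nikodym derivative is the version sought. *)
Lemma cond_exp_exists X : P.-integrable setT (EFin \o X) ->
  exists Y, cond_exp P F X Y.
Proof.
move=> iX.
(* Restriction to [F] is expressed as the image under the identity from [Omega] to [coarse], for [P]
   and for the charge alike. *)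
have Xmix := isMeasurableFun.Build _ _ _ _ _ measurable_id_coarse.
pose idm : {mfun Omega >-> coarse} := HB.pack (id : Omega -> coarse) Xmix.
pose mu := distribution P idm.
pose nu_ : {charge set coarse -> \bar R} := pushforward (induced_charge iX) idm.
pose nu := nu_ measurable_id_coarse.
have nuE A : nu A = (\int[P]_(w in A) (X w)%:E)%E by [].
have mFA (A : set Omega) : @measurable _ coarse A -> measurable A.
  by rewrite coarse_measurableE; exact: hF.2.
have dom : nu `<< mu.
  apply/null_content_dominatesP => A mA muA; rewrite nuE.
  apply: null_set_integral => //; first exact: mFA.
  by apply: measurable_funTS; exact: measurable_int iX.
set f := Radon_Nikodym nu mu.
have f_fin x : f x \is a fin_num by exact: Radon_Nikodym_fin_num.
have f_int : mu.-integrable setT f by exact: Radon_Nikodym_integrable.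
have fE A : @measurable _ coarse A -> nu A = (\int[mu]_(x in A) f x)%E.
  exact: Radon_Nikodym_integral.
have mf : measurable_fun setT f by exact: measurable_int f_int.
(* The derivative is finite at every point, so [fine] changes nothing. *)
pose Y w := fine (f w).
have YE : EFin \o Y = f by apply/funext => w; rewrite /Y /= fineK.
have mY : measurable_fun setT (f : Omega -> \bar R).
  have := measurableT_comp mf measurable_id_coarse; exact.
have iY : P.-integrable setT (f : Omega -> \bar R).
  apply/integrableP; split => //; have /integrableP[_] := f_int.
  by rewrite ge0_integral_distribution//; exact: measurableT_comp.
exists Y; split => //; first by rewrite YE.
  apply/measurable_wrtP; apply/measurable_EFinP; rewrite YE; exact: mf.
move=> A FA; have mA : @measurable _ coarse A by rewrite coarse_measurableE.
rewrite -nuE fE// /mu /distribution integral_pushforward//.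
- by rewrite -YE.
- by apply: integrableS iY => //; exact: mFA.
Qed.

End conditional_expectation.

(** If [|Z| > c], a rational [V] within [eta] of [Z] has [<V, Z> >= |Z|^2 - eta |Z|] and
    [c |V| <= c (|Z| + eta)], which is incompatible with the hypothesis for small [eta]. Countably
    many directions thus suffice. *)
Lemma fnorm_le_rational_directions (R : realType) (m n : nat)
    (Z : 'M[R]_(m, n)) c :
  0 <= c ->
  (forall V : 'M[rat]_(m, n),
     fdot (map_mx ratr V) Z <= c * fnorm (map_mx ratr V : 'M[R]_(m, n))) ->
  fnorm Z <= c.
Proof.
move=> c0 le_dir; rewrite leNgt; apply/negP => cz.
set z := fnorm Z in cz *.
(* Chosen so that [eta (c + z)] is half of the positive margin [z (z - c)]. *)
pose eta := z * (z - c) / (2 * (c + z)).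
have z0 : 0 < z by lra.
have eta0 : 0 < eta by rewrite divr_gt0 ?mulr_gt0 ?subr_gt0 ?ltr_wpDl.
(* An entrywise error [e] gives a Frobenius error of at most [eta], because [m n <= (m n + 1)^2];
   the successor avoids a zero denominator. *)
pose e := eta / (m * n).+1%:R.
have e0 : 0 < e by rewrite divr_gt0.
have /choice[V VE] (ij : 'I_m * 'I_n) :
    exists q : rat, `|ratr q - Z ij.1 ij.2| < e.
  have /rat_in_itvoo[q] : Z ij.1 ij.2 < Z ij.1 ij.2 + e by rewrite ltrDl.
  rewrite in_itv/= => /andP[q1 q2]; exists q.
  by rewrite gtr0_norm ?subr_gt0// ltrBlDl.
pose W : 'M[rat]_(m, n) := \matrix_(i, j) V (i, j).
pose W' : 'M[R]_(m, n) := map_mx ratr W.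
have close : fnorm (W' - Z) <= eta.
  rewrite -(@ler_pXn2r _ 2)// ?nnegrE ?fnorm_ge0 ?(ltW eta0)// sqr_fnorm.
  apply: (@le_trans _ _ (\sum_(i < m) \sum_(j < n) e ^+ 2)).
    apply: ler_sum => i _; apply: ler_sum => j _.
    rewrite !mxE -[X in X <= _]real_normK ?num_real//.
    rewrite ler_pXn2r ?nnegrE ?(ltW e0)//.
    exact: ltW (VE (i, j)).
  rewrite !sumr_const !card_ord -mulrnA -mulr_natl mulnC /e.
  set N := (m * n)%N; rewrite exprMn mulrCA ler_piMr ?sqr_ge0//.
  rewrite exprVn ler_pdivrMr ?exprn_gt0// mul1r -natrX ler_nat.
  by rewrite (leq_trans (leqnSn N))// leq_pmulr.
have := le_dir W; rewrite -/W'.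
have -> : W' = Z + (W' - Z) by rewrite addrC subrK.
rewrite fdotC fdotDr fdotxx -/z => le1.
have le2 := le_trans le1 (ler_wpM2l c0 (fnormD Z (W' - Z))).
have := fdot_le Z (Z - W').
rewrite -(opprB W' Z) fnormN -[- _ in X in X -> _]scaleN1r fdotZr -/z mulN1r.
move=> le3.
have le4 : z * (z - c) <= eta * (c + z) by rewrite -/z in le2; nra.
have : eta * (c + z) = z * (z - c) / 2.
  by rewrite /eta; field; rewrite gt_eqF// ltr_wpDl.
have : 0 < z * (z - c) by rewrite mulr_gt0// subr_gt0.
lra.
Qed.

Lemma ae_forall_countable d (T : measurableType d) (R : realType)
    (mu : {measure set T -> \bar R}) (I : countType) (Q : I -> T -> Prop) :
  (forall i, {ae mu, forall x, Q i x}) -> {ae mu, forall x, forall i, Q i x}.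
Proof.
move=> aeQ.
have FF : Filter (almost_everywhere mu) by apply: ae_filter_ringOfSetsType.
pose Q' n x := if unpickle n is Some i then Q i x else True.
have : {ae mu, forall x, forall n, Q' n x}.
  apply: ae_foralln => n; rewrite /Q'.
  by case: (unpickle n) => [i|]; [exact: aeQ|exact: nearW].
by apply: filterS => x Qx i; have := Qx (pickle i); rewrite /Q' pickleK.
Qed.

(** * Linearity and norm bounds for conditional expectations *)

Section conditional_expectation_linear.
Context {d : measure_display} {Omega : measurableType d} {R : realType}.
Variables (P : probability Omega R) (F : set (set Omega)).
Hypothesis hF : sub_sigma_algebra_of F.
Implicit Types X Y v : Omega -> R.

Lemma cond_exp_cst (c : R) : cond_exp P F (fun=> c) (fun=> c).
Proof.
split=> //; try exact: finite_measure_integrable_cst.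
by apply/(measurable_wrtP hF); exact: measurable_cst.
Qed.

Lemma cond_expD X1 X2 v1 v2 : cond_exp P F X1 v1 -> cond_exp P F X2 v2 ->
  cond_exp P F (fun w => X1 w + X2 w) (fun w => v1 w + v2 w).
Proof.
move=> [i1 j1 m1 E1] [i2 j2 m2 E2]; split.
- exact: (integrableD _ i1 i2).
- exact: (integrableD _ j1 j2).
- apply/(measurable_wrtP hF).
  by apply: measurable_funD; exact/(measurable_wrtP hF).
- move=> A FA; have mA := hF.2 _ FA.
  under eq_integral do rewrite EFinD.
  under [RHS]eq_integral do rewrite EFinD.
  rewrite !integralD//; do ?[exact: integrableS i1|exact: integrableS i2
    |exact: integrableS j1|exact: integrableS j2].
  by rewrite E1// E2.
Qed.

Lemma cond_expZ a X v : cond_exp P F X v ->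
  cond_exp P F (fun w => a * X w) (fun w => a * v w).
Proof.
move=> [i1 j1 m1 E1]; split.
- exact: (integrableZl _ a i1).
- exact: (integrableZl _ a j1).
- apply/(measurable_wrtP hF); apply: measurable_funM => //.
  exact/(measurable_wrtP hF).
- move=> A FA; have mA := hF.2 _ FA.
  under eq_integral do rewrite EFinM.
  under [RHS]eq_integral do rewrite EFinM.
  rewrite !integralZl//; do ?[exact: integrableS i1|exact: integrableS j1].
  by rewrite E1.
Qed.

Lemma cond_exp_sum (I : Type) (r : seq I) (X v : I -> Omega -> R) :
  (forall i, cond_exp P F (X i) (v i)) ->
  cond_exp P F (fun w => \sum_(i <- r) X i w) (fun w => \sum_(i <- r) v i w).
Proof.
move=> Xv; elim: r => [|i r ih].
  under eq_fun do rewrite big_nil.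
  under [X in cond_exp _ _ _ X]eq_fun do rewrite big_nil.
  exact: cond_exp_cst.
under eq_fun do rewrite big_cons.
under [X in cond_exp _ _ _ X]eq_fun do rewrite big_cons.
exact: cond_expD.
Qed.

(* Bounding <V, Z> for the countably many rational V avoids pulling the random
   direction Z out of the conditional expectation. *)
Lemma cond_exp_mx_bound (m n : nat) (X Z : Omega -> 'M[R]_(m, n)) c :
  0 <= c -> cond_exp_mx P F X Z -> {ae P, forall w, fnorm (X w) <= c} ->
  {ae P, forall w, fnorm (Z w) <= c}.
Proof.
move=> c0 XZ Xc.
have FF : Filter (almost_everywhere P) by apply: ae_filter_ringOfSetsType.
have : {ae P, forall w, forall V : 'M[rat]_(m, n),
    fdot (map_mx ratr V) (Z w) <= c * fnorm (map_mx ratr V : 'M[R]_(m, n))}.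
  apply: ae_forall_countable => V; set W := map_mx _ V.
  apply: (cond_exp_ae_le hF (X1 := fun w => fdot W (X w))
    (X2 := fun=> c * fnorm W)).
  - by apply: cond_exp_sum => i; apply: cond_exp_sum => j; exact: cond_expZ.
  - exact: cond_exp_cst.
  - apply: filterS Xc => w Xw; rewrite (le_trans (fdot_le _ _))// mulrC.
    by rewrite ler_wpM2r// fnorm_ge0.
by apply: filterS => w; exact: fnorm_le_rational_directions.
Qed.

Lemma cond_exp_mx_exists (m n : nat) (X : Omega -> 'M[R]_(m, n)) :
  (forall i j, P.-integrable setT (EFin \o (fun w => X w i j))) ->
  exists Y : Omega -> 'M[R]_(m, n), cond_exp_mx P F X Y.
Proof.
move=> iX.
have /choice[Y XY] (ij : 'I_m * 'I_n) :
    exists Y : Omega -> R, cond_exp P F (fun w => X w ij.1 ij.2) Y.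
  exact: cond_exp_exists.
exists (fun w => \matrix_(i, j) Y (i, j) w) => i j.
by under [X in cond_exp _ _ _ X]eq_fun do rewrite mxE; exact: (XY (i, j)).
Qed.

End conditional_expectation_linear.

Lemma poly_closed_entry_sqr_fnorm (R : realType) (T : Type)
    (Pr : (T -> R) -> Prop) (m n : nat) (M : T -> 'M[R]_(m, n)) :
  poly_closed Pr -> entries_in Pr M -> Pr (fun t => fnorm (M t) ^+ 2).
Proof.
move=> Pcl PM; under eq_fun do rewrite sqr_fnorm.
apply: (poly_closed_sum Pcl) => i; apply: (poly_closed_sum Pcl) => j.
by under eq_fun do rewrite expr2; case: Pcl => _ _; apply.
Qed.

(** Removes the slack that keeps a denominator positive in the second moment estimate. *)
Lemma ler_sqr_limit (R : realType) (v a : R) :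
  (forall k, v <= (a + k.+1%:R^-1) ^+ 2) -> v <= a ^+ 2.
Proof.
move=> va.
have cv : a + harmonic k @[k --> \oo] --> a.
  rewrite -[X in _ --> X]addr0; apply: cvgD; first exact: cvg_cst.
  exact: cvg_harmonic.
have h : (a + harmonic k) ^+ 2 @[k --> \oo] --> a ^+ 2.
  by under eq_fun do rewrite expr2; rewrite expr2; exact: cvgM.
rewrite -(cvg_lim _ h)//; apply: limr_ge.
  by apply/cvg_ex; eexists; exact: h.
exact: nearW.
Qed.

(** * Perturbation of the estimator *)

Section perturbation.
Context {d : measure_display} {Omega : measurableType d} {R : realType}.
Variables (P : probability Omega R) (F : set (set Omega)).
Hypothesis hF : sub_sigma_algebra_of F.
Context {m n : nat}.
Variables (G G' g : Omega -> 'M[R]_(m, n)) (b t eps delta : R).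
Hypotheses (t0 : 0 <= t) (eps0 : 0 <= eps).
Hypothesis mG' : entries_in (fun f : Omega -> R => measurable_fun setT f) G'.
Hypothesis close : {ae P, forall w, fnorm (G' w - G w) <= eps}.

Let FF : Filter (almost_everywhere P).
Proof. exact: ae_filter_ringOfSetsType. Qed.

(** The weight [eps / s] is tuned so that [(1 + eps / s) s^2 + eps s + eps^2 = (s + eps)^2];
    linearity and monotonicity then replace a conditional Cauchy-Schwarz inequality. Strictness of
    [t < s] makes [s] positive even when [t = 0]. *)
Lemma cond_exp_sqr_perturb vG v s : t < s ->
  cond_exp P F (fun w => fnorm (G w) ^+ 2) vG ->
  {ae P, forall w, vG w <= t ^+ 2} ->
  cond_exp P F (fun w => fnorm (G' w) ^+ 2) v ->
  {ae P, forall w, v w <= (s + eps) ^+ 2}.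
Proof.
move=> ts EG vGt EG'; have s0 : 0 < s by exact: le_lt_trans ts.
have EB := cond_expD hF (cond_expZ hF (1 + eps / s) EG)
  (cond_exp_cst P hF (eps * s + eps ^+ 2)).
have : {ae P, forall w, fnorm (G' w) ^+ 2 <=
    (1 + eps / s) * fnorm (G w) ^+ 2 + (eps * s + eps ^+ 2)}.
  apply: filterS close => w /= cw.
  have := fnormD (G' w - G w) (G w); rewrite subrK => le1.
  have le2 : fnorm (G' w) <= fnorm (G w) + eps by lra.
  have := fnorm_ge0 (G w); have := fnorm_ge0 (G' w).
  move: le2; move: (fnorm (G' w)) (fnorm (G w)) => x y xy x0 y0.
  (* AM-GM: [2 eps y <= (eps / s) y^2 + eps s]. *)
  have amgm : 2 * eps * y <= eps / s * y ^+ 2 + eps * s.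
    rewrite -subr_ge0 (_ : _ - _ = eps / s * (y - s) ^+ 2).
      by rewrite mulr_ge0 ?sqr_ge0// divr_ge0// ltW.
    by field; rewrite gt_eqF.
  have : x ^+ 2 <= (y + eps) ^+ 2 by rewrite ler_pXn2r ?nnegrE// addr_ge0.
  by rewrite sqrrD; lra.
move=> /(cond_exp_ae_le hF EG' EB) vB; apply: filterS2 vB vGt => w /= le1 le2.
apply: (le_trans le1).
have e0 : 0 <= eps / s by rewrite divr_ge0// ltW.
have : (1 + eps / s) * vG w <= (1 + eps / s) * s ^+ 2.
  rewrite ler_wpM2l//; first by rewrite addr_ge0.
  by rewrite (le_trans le2)// ler_pXn2r ?nnegrE ?(ltW ts)// ltW.
rewrite [X in _ <= X -> _](_ : _ = s ^+ 2 + eps * s); last first.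
  by field; rewrite gt_eqF.
by rewrite sqrrD; lra.
Qed.

(** The bias grows by the conditional mean of [G' - G], of norm at most [eps]; the second moment
    bound comes from letting [s] decrease to [t]; the event [|G| <= t] is almost surely contained in
    [|G'| <= t + eps]. *)
Lemma estimator_bounds_perturb :
  estimator_bounds P F G g b (t ^+ 2) t delta ->
  estimator_bounds P F G' g (b + eps) ((t + eps) ^+ 2) (t + eps) delta.
Proof.
move=> [[Y GY Yg] [vG EG vGt] [pG EpG pGd]].
have sub_le w : fnorm (G' w) <= fnorm (G' w - G w) + fnorm (G w).
  by rewrite -{1}(subrK (G w) (G' w)) fnormD.
have Pcl := @poly_closed_measurable R _ Omega.
have m2 : measurable_fun setT (fun w => fnorm (G' w) ^+ 2).
  exact: (poly_closed_entry_sqr_fnorm Pcl).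
split.
- have [i j|Y' GY'] := @cond_exp_mx_exists _ _ _ P F hF m n G'.
    apply: (@le_integrable_ae _ _ _ _ _ (fun w => (`|G w i j| + eps)%:E)).
    + exact/measurable_EFinP/mG'.
    + apply: filterS close => w cw /=.
      rewrite lee_fin [leRHS]ger0_norm ?addr_ge0//.
      have -> : G' w i j = (G' w - G w) i j + G w i j by rewrite !mxE subrK.
      rewrite (le_trans (ler_normD _ _))//.
      by rewrite addrC lerD2l (le_trans (ler_norm_fnorm _ _ _)).
    + have [iG _ _ _] := GY i j.
      exact: (integrableD measurableT (integrable_norm iG)
        (finite_measure_integrable_cst P _ measurableT)).
  exists Y' => //.
  have EZ : cond_exp_mx P F (fun w => G' w - G w) (fun w => Y' w - Y w).
    move=> i j; have := cond_expD hF (GY' i j) (cond_expZ hF (-1) (GY i j)).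
    congr cond_exp;
      by apply/funext => w; rewrite !mxE mulN1r.
  have := cond_exp_mx_bound hF eps0 EZ close.
  apply: filterS2 Yg => w /= le1 le2.
  rewrite -(subrK (Y w) (Y' w)) -addrA (le_trans (fnormD _ _))// [leRHS]addrC.
  exact: lerD.
- have [|v Ev] := @cond_exp_exists _ _ _ P F hF (fun w => fnorm (G' w) ^+ 2).
    apply: (@le_integrable_ae _ _ _ _ _
      (fun w => (2 * (fnorm (G w) ^+ 2) + 2 * eps ^+ 2)%:E)).
    + exact/measurable_EFinP.
    + apply: filterS close => w cw /=; rewrite lee_fin ger0_norm ?sqr_ge0//.
      have r0 : 0 <= 2 * fnorm (G w) ^+ 2 + 2 * eps ^+ 2.
        by rewrite addr_ge0// mulr_ge0// sqr_ge0.
      rewrite (ger0_norm r0).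
      have le1 := le_trans (sub_le w) (lerD cw (lexx _)).
      have : fnorm (G' w) ^+ 2 <= (eps + fnorm (G w)) ^+ 2.
        by rewrite ler_pXn2r ?nnegrE ?addr_ge0 ?fnorm_ge0// fnorm_ge0.
      have := sqr_ge0 (eps - fnorm (G w)); rewrite sqrrB sqrrD; lra.
    + have [iG _ _ _] := EG.
      exact: (integrableD measurableT (integrableZl measurableT 2 iG)
        (finite_measure_integrable_cst P (2 * eps ^+ 2) measurableT)).
  exists v => //.
  (* The levels [s = t + 1 / (k + 1)] are countably many, so one null set serves all of them. *)
  have : {ae P, forall w, forall k : nat, v w <= (t + k.+1%:R^-1 + eps) ^+ 2}.
    apply: ae_foralln => k.
    by apply: cond_exp_sqr_perturb EG vGt Ev; rewrite ltrDl invr_gt0.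
  apply: filterS => w vw; apply: ler_sqr_limit => k.
  by rewrite addrAC.
- have mset : measurable [set w | fnorm (G' w) <= t + eps].
    (* The norm is squared to become a polynomial in the entries, whose measurability is at hand. *)
    rewrite (_ : [set _ | _] = (fun w => fnorm (G' w) ^+ 2) @^-1`
        `]-oo, (t + eps) ^+ 2]%classic).
      by rewrite -[X in measurable X]setTI; exact: m2.
    by apply/seteqP; split=> w /=;
      rewrite in_itv/= ler_pXn2r// nnegrE ?fnorm_ge0// addr_ge0.
  have [|p Ep] := @cond_exp_exists _ _ _ P F hF
      (\1_[set w | fnorm (G' w) <= t + eps]).
    exact: integrable_indic.
  exists p => //.
  have : {ae P, forall w, (\1_[set w | fnorm (G w) <= t] w : R) <=
      \1_[set w | fnorm (G' w) <= t + eps] w}.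
    apply: filterS close => w cw; rewrite !indicE ler_nat.
    have : w \in [set w | fnorm (G w) <= t] ->
        w \in [set w | fnorm (G' w) <= t + eps].
      rewrite !inE /= => Gt; rewrite (le_trans (sub_le w))// [leRHS]addrC.
      exact: lerD.
    by case: (w \in _) => // ->.
  move=> /(cond_exp_ae_le hF EpG Ep).
  by apply: filterS2 pGd => w /=; exact: le_trans.
Qed.

End perturbation.

(** * Laws of the samples and bounds for the truncated estimator *)

Lemma ae_has_law d (Omega : measurableType d) (R : realType)
    (P : probability Omega R) (m n : nat) (X : Omega -> borel R m n)
    (D : probability (borel R m n) R) (Q : borel R m n -> Prop) :
  has_law P X D -> {ae D, forall x, Q x} -> {ae P, forall w, Q (X w)}.
Proof.
move=> [mX lawX] [N [mN DN0 QN]]; exists (X @^-1` N); split.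
- by rewrite -[Y in measurable Y]setTI; exact: mX.
- by rewrite lawX.
- by move=> w /= Qw; exact: QN.
Qed.

Lemma entries_in_borel d (Omega : measurableType d) (R : realType) (m n : nat)
    (X : Omega -> borel R m n) : measurable_fun setT X ->
  entries_in (fun f : Omega -> R => measurable_fun setT f) X.
Proof. by move=> mX i j; exact: measurableT_comp (measurable_entry i j) mX. Qed.

Lemma entries_in_two_point (R : realType) (m n : nat) (S : lqr R m n) h alpha
    (T : Type) (Pr : (T -> R) -> Prop) (K U : T -> 'M[R]_(m, n))
    (x : T -> 'cV[R]_n) :
  poly_closed Pr -> entries_in Pr K -> entries_in Pr x -> entries_in Pr U ->
  entries_in Pr (fun t => two_point (Ftrunc S h) alpha (K t) (x t) (U t)).
Proof.
move=> Pcl PK Px PU; have [Pc PD PM] := Pcl.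
have PaU : entries_in Pr (fun t => alpha *: U t) by exact: entries_inZ.
have PF V : entries_in Pr V -> Pr (fun t => Ftrunc S h (V t) (x t)).
  by move=> PV; exact: Ftrunc_closed.
apply: entries_inZ => //; apply: (PM (fun=> _)); first exact: Pc.
have PFp := PF _ (entries_inD Pcl PK PaU).
have PFm := PF _ (entries_inB Pcl PK PaU).
apply: PD => //; under eq_fun do rewrite -mulN1r.
by apply: PM.
Qed.

Theorem proposition4p2 (R : realType) (m n : nat) (S : lqr R m n)
  (hQ : posdef (costQ S)) (hR : posdef (costR S))
  (D : probability (borel R n 1) R) (DX : R) (hDX : 0 < DX)
  (hD : state_law D DX)
  (fstar : R) (hfstar : is_min_cost S D fstar)
  (mu : R) (hmu : 0 < mu) (L r ell : R -> R)
  (hLr : forall Delta : R, 0 < Delta ->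
     smoothness_constants S D fstar mu Delta (L Delta) (r Delta))
  (hr2 : forall Delta : R, 0 < Delta ->
     radius_in_double_sublevel S D fstar Delta (r Delta))
  (d : measure_display) (Omega : measurableType d) (P : probability Omega R)
  (Ft : set (set Omega)) (hFt : sub_sigma_algebra_of Ft)
  (x0 : Omega -> borel R n 1) (U : Omega -> borel R m n)
  (hsamples : fresh_samples P Ft D x0 U)
  (hell : forall Delta : R, 0 < Delta ->
     0 <= ell Delta /\
     forall alpha : R, 0 < alpha <= r Delta ->
     forall delta : R, 0 < delta < 1 ->
     forall Kt : Omega -> borel R m n,
     admissible_policy P Ft S D fstar Delta Kt ->
     estimator_bounds P Ft
       (two_point_process (Finf S) alpha Kt x0 U)
       (fun w => grad_cost S D (Kt w))
       (L Delta * alpha)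
       ((m * n)%:R ^+ 2 * ell Delta ^+ 2)
       ((m * n)%:R * ell Delta)
       delta) :
  forall Delta : R, 0 < Delta ->
  forall alpha : R, 0 < alpha <= r Delta ->
  forall h : nat, (1 <= h)%N ->
  forall delta : R, 0 < delta < 1 ->
  forall Kt : Omega -> borel R m n,
  admissible_policy P Ft S D fstar Delta Kt ->
  estimator_bounds P Ft
    (two_point_process (Ftrunc S h) alpha Kt x0 U)
    (fun w => grad_cost S D (Kt w))
    (L Delta * alpha + eps_h S fstar DX Delta alpha h)
    (((m * n)%:R * ell Delta + eps_h S fstar DX Delta alpha h) ^+ 2)
    ((m * n)%:R * ell Delta + eps_h S fstar DX Delta alpha h)
    delta.
Proof.
move=> Delta Delta0 alpha /andP[alpha0 alphar] h _ delta delta01 Kt hKt.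
have [ell0 bounds] := hell _ Delta0.
have [mKt gapKt] := hKt.
have [mU U1 _] := fresh_U_law hsamples.
have law_x0 := fresh_x0_law hsamples.
have x0D := ae_has_law law_x0 hD.2.
have fstar0 : 0 <= fstar.
  by have [[K0 cK0] _] := hfstar; rewrite -lee_fin -cK0 (cost_ge0 hQ hR hD).
have f2 : 0 < fstar + 2 * Delta by rewrite ltr_wpDl// mulr_gt0.
(* The constants of level [Delta + 1] serve the boundary case [gap = Delta], which an admissible
   policy may reach. *)
have tr K K' : (gap S D fstar K <= Delta%:E)%E -> fnorm (K' - K) <= r Delta ->
    forall h, trunc_trace S h K' <= fstar + 2 * Delta.
  have Delta1 : 0 < Delta + 1 by rewrite addr_gt0.
  exact: (trunc_trace_double_sublevel hQ hR hD hmu Delta0 (hLr _ Delta1)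
    (hr2 _ Delta0)).
have FF : Filter (almost_everywhere P) by apply: ae_filter_ringOfSetsType.
have close : {ae P, forall w,
    fnorm (two_point_process (Ftrunc S h) alpha Kt x0 U w -
           two_point_process (Finf S) alpha Kt x0 U w)
    <= eps_h S fstar DX Delta alpha h}.
  apply: filterS3 gapKt x0D U1 => w gapw xw Uw.
  apply: (two_point_truncation hQ hR) => // V Va.
  by apply: (tr (Kt w)) => //; rewrite addrC addKr (le_trans Va).
(* As [P] has mass 1, the almost sure bound holds at some sample point, where [eps_h] dominates a
   norm. *)
have eps0 : 0 <= eps_h S fstar DX Delta alpha h.
  have PF : ProperFilter (almost_everywhere P).
    apply: ae_properfilter_algebraOfSetsType.
    suff : (0 < P [set: Omega])%E by [].
    by rewrite probability_setT lte01.
  by have [w /(le_trans (fnorm_ge0 _))] := filter_ex close.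
apply: (estimator_bounds_perturb hFt _ eps0 _ close).
- by rewrite mulr_ge0.
- apply: (entries_in_two_point S h alpha (poly_closed_measurable _ _));
    apply: entries_in_borel => //; last exact: law_x0.1.
  exact: measurable_wrtW hFt _ _ _ mKt.
- by rewrite exprMn; apply: bounds => //; rewrite alpha0.
Qed.
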